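(* Let $(\mathsf X, d, \preceq)$ be a preordered metric space such that $d$ is complete and satisfies the diagonal property with respect to $\preceq$, and such that the preorder $\preceq$ is closed with respect to $d$. Let $T:\mathsf X\to\mathsf X$ be order-preserving. Then the following statements are equivalent: (i) $T$ is asymptotically contractive and has at least one order-bounded trajectory. (ii) $T$ is globally stable.
   Context: A preorder is a reflexive transitive relation. A preordered metric space is a triple $(\mathsf X,d,\preceq)$ with $(\mathsf X,d)$ a metric space and $\preceq$ a preorder on $\mathsf X$. For $a\preceq b$, the order interval is $[a,b]=\{x\in\mathsf X: a\preceq x\preceq b\}$. The preorder is closed if $x_i\preceq y_i$ for all $i\in\mathbb N$, $x_i\to x$ and $y_i\to y$ in $\mathsf X$ imply $x\preceq y$. The metric $d$ has the diagonal property with respect to $\preceq$ if, for all $a,b\in \mathsf X$, $d(x,y)\le d(a,b)$ whenever $x,y\in[a,b]$. $T^t$ denotes the $t$-fold composition of $T$ with itself ($T^0$ is the identity). $T$ is order-preserving if $x\preceq y$ implies $Tx\preceq Ty$. $T$ has an order-bounded trajectory if there exist $x,a,b\in\mathsf X$ with $a\preceq T^tx\preceq b$ for all $t\in\mathbb Z_+$. $T$ is asymptotically contractive if $d(T^tx,T^ty)\to0$ as $t\to\infty$ for all $x,y\in\mathsf X$. $T$ is globally stable if it has a unique fixed point $x^*\in\mathsf X$ and $d(T^tx,x^* )\to0$ as $t\to\infty$ for all $x\in\mathsf X$. *)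

(* Defs.v *)
From Corelib Require Export RelationClasses.
From mathcomp Require Import all_boot all_order all_algebra.
From mathcomp Require Import boolp classical_sets filter reals topology.

Set Implicit Arguments.
Unset Strict Implicit.
Unset Printing Implicit Defensive.

Import Order.TTheory GRing.Theory Num.Theory.
Import numFieldTopology.Exports.

Local Open Scope classical_set_scope.
Local Open Scope ring_scope.

Section PreorderedMetric.
Context {R : realType} {X : metricType R}.
Implicit Types (le : X -> X -> Prop) (T : X -> X).

(* [completePseudoMetricType] is not used because it also requires the space
   to be pointed, hence nonempty. *)
Definition complete_metric : Prop :=
  forall u : nat -> X, cauchy (u @ \oo) -> exists l : X, u @ \oo --> l.

Definition order_interval le (a b : X) : set X :=
  [set x | le a x /\ le x b].

Definition closed_preorder le : Prop :=
  forall (x_ y_ : nat -> X) (x y : X),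
    (forall i, le (x_ i) (y_ i)) ->
    x_ @ \oo --> x -> y_ @ \oo --> y -> le x y.

Definition diagonal_property le : Prop :=
  forall a b x y : X,
    order_interval le a b x -> order_interval le a b y ->
    mdist x y <= mdist a b.

Definition order_preserving le T : Prop := {homo T : x y / le x y}.

Definition order_bounded_trajectory le T : Prop :=
  exists x a b : X, forall t : nat, order_interval le a b (iter t T x).

Definition asymptotically_contractive T : Prop :=
  forall x y : X,
    mdist (iter t T x) (iter t T y) @[t --> \oo] --> (0 : R).

Definition globally_stable T : Prop :=
  exists2 xs : X, unique (fun x => T x = x) xs &
    forall x : X, mdist (iter t T x) xs @[t --> \oo] --> (0 : R).

End PreorderedMetric.

Arguments complete_metric {R} X.

(* Main.v *)
Require Import Defs.
From mathcomp Require Import all_boot all_order all_algebra.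
From mathcomp Require Import boolp classical_sets filter reals topology.
From mathcomp Require Import normedtype.

(** Suppose [T] is asymptotically contractive and the orbit of [x] stays in the
    order interval [[a, b]].  Applying [T^n] to [a <= T^t x <= b] traps the
    whole tail [T^m x], [m >= n], in [[T^n a, T^n b]] ([orbit_tail_interval]).
    By the diagonal property this interval has diameter at most
    [d(T^n a, T^n b)], which tends to [0] by asymptotic contractivity.  So the
    orbit is Cauchy ([cauchy_bounded_orbit]) and converges to some [l];
    closedness of the preorder puts [l] in every [[T^n a, T^n b]].  Since [T]
    maps each of these intervals into the next one, [T l] and [l] both lie in
    [[T^n.+1 a, T^n.+1 b]] for all [n].  Their distance is therefore [0] and
    [l] is fixed ([bounded_orbit_fixpoint]).  Contractivity then attracts every
    orbit to [l], which also makes [l] unique.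

    Conversely, the orbit of a fixed point is constant, hence order-bounded by
    reflexivity, and two orbits with a common limit approach each other by the
    triangle inequality. *)

Set Implicit Arguments.
Unset Strict Implicit.
Unset Printing Implicit Defensive.

Import Order.TTheory GRing.Theory Num.Theory.
Import numFieldNormedType.Exports.

Local Open Scope classical_set_scope.
Local Open Scope ring_scope.

Section MetricSequences.
Context {R : realType} {X : metricType R}.
Implicit Types (u v : nat -> X) (x y l : X) (r : nat -> R).

Lemma mdist_eq0_cvg x y r :
  (forall n, mdist x y <= r n) -> r n @[n --> \oo] --> (0 : R) -> x = y.
Proof.
move=> ler r0; apply: mdist_positivity; apply/eqP.
rewrite eq_le mdist_ge0 andbT.
by apply: (cvgr_to_ge r0); apply: nearW.
Qed.

(** A null majorant of the diameters of the tails is the form of the Cauchy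
    criterion that shrinking sets give. *)
Lemma cauchy_tail_diam u r :
  (forall n p q, (n <= p)%N -> (n <= q)%N -> mdist (u p) (u q) <= r n) ->
  r n @[n --> \oo] --> (0 : R) -> cauchy (u @ \oo).
Proof.
move=> diam r0; apply: cauchy_exP => e e0.
have /cvgrPdist_lt/(_ e e0)[N _ rN] := r0.
exists (u N); exists N => // p /= Np; rewrite ballEmdist/=.
apply: (le_lt_trans (diam N N p (leqnn N) Np)).
have /= := rN N (leqnn N); rewrite sub0r normrN.
exact: le_lt_trans (ler_norm _).
Qed.

Lemma cvg_mdist_common u v l :
  mdist (u n) l @[n --> \oo] --> (0 : R) ->
  mdist (v n) l @[n --> \oo] --> (0 : R) ->
  mdist (u n) (v n) @[n --> \oo] --> (0 : R).
Proof.
move=> ul vl.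
have uvl : mdist (u n) l + mdist (v n) l @[n --> \oo] --> (0 : R).
  by rewrite -[X in _ --> X]addr0; exact: cvgD.
apply: squeeze_cvgr (cvg_cst (0 : R)) uvl; apply: nearW => n.
by rewrite mdist_ge0 /= (metric_sym (v n)) metric_triangle.
Qed.

End MetricSequences.

Section BoundedOrbits.
Context {R : realType} {X : metricType R}.
Variables (le : X -> X -> Prop) (T : X -> X).
Hypothesis Tmono : order_preserving le T.
Implicit Types a b x l : X.

Lemma iter_order_interval n a b x :
  order_interval le a b x ->
  order_interval le (iter n T a) (iter n T b) (iter n T x).
Proof.
by move=> [ax xb]; split; elim: n => //= n IHn; exact: Tmono.
Qed.

Lemma orbit_tail_interval a b x n m :
  (forall t, order_interval le a b (iter t T x)) -> (n <= m)%N ->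
  order_interval le (iter n T a) (iter n T b) (iter m T x).
Proof.
by move=> abx nm; rewrite -(subnKC nm) iterD; exact: iter_order_interval.
Qed.

Hypothesis diag : diagonal_property le.

Lemma cauchy_bounded_orbit a b x :
  (forall t, order_interval le a b (iter t T x)) ->
  mdist (iter n T a) (iter n T b) @[n --> \oo] --> (0 : R) ->
  cauchy ((fun t => iter t T x) @ \oo).
Proof.
move=> abx; apply: cauchy_tail_diam => n p q np nq.
by apply: diag; exact: orbit_tail_interval.
Qed.

Lemma closed_order_interval a b u l : closed_preorder le ->
  (forall n : nat, order_interval le a b (u n)) -> u @ \oo --> l ->
  order_interval le a b l.
Proof.
move=> lecl abu ul; split.
  by apply: (lecl (fun=> a) u) => // [i|]; [have [] := abu i|exact: cvg_cst].
by apply: (lecl u (fun=> b)) => // [i|]; [have [] := abu i|exact: cvg_cst].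
Qed.

(** Continuity of [T] is replaced by the fact that [T] sends the interval
    [[T^n a, T^n b]] into [[T^n.+1 a, T^n.+1 b]]. *)
Lemma bounded_orbit_fixpoint a b x l : closed_preorder le ->
  (forall t, order_interval le a b (iter t T x)) ->
  mdist (iter n T a) (iter n T b) @[n --> \oo] --> (0 : R) ->
  (fun t => iter t T x) @ \oo --> l -> T l = l.
Proof.
move=> lecl abx ab0 xl.
have lI n : order_interval le (iter n T a) (iter n T b) l.
  have xnl : iter (p + n) T x @[p --> \oo] --> l.
    exact: (cvg_comp _ _ (cvg_addnr n) xl).
  apply: (closed_order_interval lecl _ xnl) => p.
  exact: orbit_tail_interval (leq_addl _ _).
have TlI n : order_interval le (iter n.+1 T a) (iter n.+1 T b) (T l).
  by have [al lb] := lI n; split; exact: Tmono.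
(* Both points lie in every interval of index [n.+1], so the null sequence is
   shifted by one. *)
pose r n := mdist (iter n.+1 T a) (iter n.+1 T b).
apply: (@mdist_eq0_cvg _ _ _ _ r).
  by move=> n; exact: diag (TlI n) (lI n.+1).
exact: (cvg_comp _ _ (cvg_addnl 1) ab0).
Qed.

End BoundedOrbits.

Lemma iter_fixpoint (X : Type) (T : X -> X) (l : X) n :
  T l = l -> iter n T l = l.
Proof. by move=> Tl; elim: n => //= n ->. Qed.

Lemma contractive_fixpoint_stable (R : realType) (X : metricType R)
    (T : X -> X) (l : X) :
  asymptotically_contractive T -> T l = l -> globally_stable T.
Proof.
move=> contr Tl; have to_l x : mdist (iter t T x) l @[t --> \oo] --> (0 : R).
  by have := contr x l; under eq_fun do rewrite (iter_fixpoint _ Tl).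
exists l => //; split=> // y Ty; apply/esym/(mdist_eq0_cvg _ (to_l y)) => n.
by rewrite iter_fixpoint.
Qed.

Lemma globally_stable_contractive (R : realType) (X : metricType R)
    (T : X -> X) :
  globally_stable T -> asymptotically_contractive T.
Proof. by move=> [l _ to_l] x y; exact: cvg_mdist_common (to_l x) (to_l y). Qed.

Lemma fixpoint_bounded_trajectory (R : realType) (X : metricType R)
    (le : X -> X -> Prop) (T : X -> X) (l : X) :
  Reflexive le -> T l = l -> order_bounded_trajectory le T.
Proof.
by move=> lerefl Tl; exists l, l, l => t; rewrite iter_fixpoint//; split.
Qed.

Theorem corollary2p1 (R : realType) (X : metricType R) (le : X -> X -> Prop)
    (T : X -> X) :
  PreOrder le ->
  complete_metric X ->
  diagonal_property le ->
  closed_preorder le ->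
  order_preserving le T ->
  (asymptotically_contractive T /\ order_bounded_trajectory le T)
  <-> globally_stable T.
Proof.
move=> [lerefl _] compl diag lecl Tmono; split=> [[contr [x [a [b abx]]]]|stab].
  have [l xl] := compl _ (cauchy_bounded_orbit Tmono diag abx (contr a b)).
  apply: (contractive_fixpoint_stable contr).
  exact: (bounded_orbit_fixpoint Tmono diag lecl abx (contr a b) xl).
split; first exact: globally_stable_contractive.
by have [l [Tl _] _] := stab; exact: fixpoint_bounded_trajectory Tl.
Qed.
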